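(* Let $K$ be a field with a non-trivial valuation $v$, and let $A(x)=\sum_{i=0}^n a_ix^i\in K[x]$ be a polynomial of degree $n$ with $n\cdot 1_K\neq 0$. If either $U(A(x))=A\big(x-\frac{a_{n-1}}{na_n}\big)$ is an Eisenstein–Dumas polynomial at $v$, or $a_0\neq 0$ and $L(A(x))=\big(1-\frac{a_1}{na_0}x\big)^nA\big(\frac{x}{1-\frac{a_1}{na_0}x}\big)$ is an Eisenstein–Dumas polynomial at $v$, then $A(x)$ is irreducible in $K[x]$.
   Context: $v:K\to\Gamma\cup\{\infty\}$ is a non-trivial Krull valuation with values in a linearly ordered abelian group $\Gamma$ ($v(a)=\infty$ iff $a=0$, $v(ab)=v(a)+v(b)$, $v(a+b)\ge\min\{v(a),v(b)\}$); $K$ is not assumed henselian. For a polynomial written as $B(x)=\sum_{i=0}^n b_ix^i$ with a specified $n$, $B$ is an Eisenstein–Dumas polynomial at $v$ if (D0) $b_0b_n\neq0$; (D1) $v(b_0)-v(b_n)\notin k\Gamma=\{kg:g\in\Gamma\}$ for every integer $k>1$ dividing $n$; (D2) $nv(b_i)\ge (n-i)v(b_0)+iv(b_n)$ for $0\le i\le n$. The polynomials $U(A(x))$ and $L(A(x))$ are regarded as polynomials of formal degree $n$ (written $\sum_{i=0}^n b_ix^i$ with coefficients of $x^0,\dots,x^n$); equivalently $U(A(x))=A(x)\begin{pmatrix}1&-\frac{a_{n-1}}{na_n}\\0&1\end{pmatrix}$ and $L(A(x))=A(x)\begin{pmatrix}1&0\\-\frac{a_1}{na_0}&1\end{pmatrix}$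 under the action $A(x)\begin{pmatrix}a&b\\c&d\end{pmatrix}=(cx+d)^nA\big(\frac{ax+b}{cx+d}\big)$. *)

(* Defs.v *)
From HB Require Import structures.
From mathcomp Require Import all_boot all_order all_algebra.

Set Implicit Arguments.
Unset Strict Implicit.
Unset Printing Implicit Defensive.

Import Order.TTheory GRing.Theory Num.Theory.
Local Open Scope ring_scope.

(* [porderZmodType] does not relate the order to the addition. Totality is a
   field rather than inherited from [Order.Total] because HB rejects a join of
   [Order.Total] and [GRing.Zmodule] below [Num.RealDomain]. *)
HB.mixin Record POrderedZmodule_isOrderedGroup G of Num.POrderedZmodule G := {
  og_total : forall x y : G, (x <= y) || (y <= x);
  og_lerD2l : forall z x y : G, x <= y -> z + x <= z + y
}.

#[short(type="orderedGroupType")]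
HB.structure Definition OrderedGroup :=
  { G of Num.POrderedZmodule G & POrderedZmodule_isOrderedGroup G }.

(* G together with an absorbing largest element, written None *)
Definition with_infty (G : Type) : Type := option G.

Section WithInfty.
Variable G : orderedGroupType.
Local Notation T := (with_infty G).

HB.instance Definition _ := Choice.on T.

Definition wi_add (x y : T) : T :=
  if (x, y) is (Some a, Some b) then Some (a + b) else None.

Fact wi_addA : associative wi_add.
Proof. by move=> [a|] [b|] [c|] //=; rewrite /wi_add addrA. Qed.

Fact wi_addC : commutative wi_add.
Proof. by move=> [a|] [b|] //=; rewrite /wi_add addrC. Qed.

Fact wi_add0 : left_id (Some 0 : T) wi_add.
Proof. by move=> [a|] //=; rewrite /wi_add add0r. Qed.

HB.instance Definition _ := GRing.isNmodule.Build T wi_addA wi_addC wi_add0.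

Definition wi_le (x y : T) : bool :=
  match x, y with
  | _, None => true
  | None, Some _ => false
  | Some a, Some b => a <= b
  end.

Fact wi_le_refl : reflexive wi_le.
Proof. by move=> [a|] /=. Qed.

Fact wi_le_anti : antisymmetric wi_le.
Proof. by move=> [a|] [b|] //= /le_anti ->. Qed.

Fact wi_le_trans : transitive wi_le.
Proof. by move=> [b|] [a|] [c|] //=; apply: le_trans. Qed.

Fact wi_le_total : total wi_le.
Proof. by move=> [a|] [b|] //=; apply: og_total. Qed.

HB.instance Definition _ :=
  Order.Le_isPOrder.Build ring_display T wi_le_refl wi_le_anti wi_le_trans.
HB.instance Definition _ := Order.POrder_isTotal.Build ring_display T wi_le_total.

Definition infty : T := None.

(* inverse of the inclusion of G; the value at infty is junk *)
Definition finite_part (x : T) : G := odflt 0 x.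

End WithInfty.

Arguments infty {G}.

Record krull_valuation (K : fieldType) (G : orderedGroupType) :=
  KrullValuation {
    valuation_fun :> K -> with_infty G;
    valuation_inftyP : forall a, valuation_fun a = infty <-> a = 0;
    valuationM : forall a b,
      valuation_fun (a * b) = valuation_fun a + valuation_fun b;
    valuationD : forall a b,
      Num.min (valuation_fun a) (valuation_fun b) <= valuation_fun (a + b)
  }.

Definition nontrivial_valuation (K : fieldType) (G : orderedGroupType)
    (v : krull_valuation K G) : Prop :=
  exists2 a : K, a != 0 & v a != 0.

(* The formal degree n is a parameter: B is read as
   B`_0 + B`_1 'X + ... + B`_n 'X^n. *)
Record eisenstein_dumas (K : fieldType) (G : orderedGroupType)
    (v : krull_valuation K G) (n : nat) (B : {poly K}) : Prop :=
  EisensteinDumas {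
    ED_size : (size B <= n.+1)%N;
    ED_D0 : B`_0 * B`_n != 0;
    ED_D1 : forall k : nat, (1 < k)%N -> (k %| n)%N ->
      ~ exists g : G, finite_part (v B`_0) - finite_part (v B`_n) = g *+ k;
    ED_D2 : forall i : nat, (i <= n)%N ->
      v B`_0 *+ (n - i) + v B`_n *+ i <= v B`_i *+ n
  }.

Section Transforms.
Variables (K : fieldType) (n : nat).

(* (c x + d)^n A((a x + b) / (c x + d)) for A of degree at most n, with the
   denominators cleared; see [gl2_actE] *)
Definition gl2_act (A : {poly K}) (a b c d : K) : {poly K} :=
  \sum_(i < n.+1)
    A`_i *: ((a *: 'X + b%:P) ^+ i * (c *: 'X + d%:P) ^+ (n - i)).

Definition U_transform (A : {poly K}) : {poly K} :=
  A \Po ('X - (A`_n.-1 / (n%:R * A`_n))%:P).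

Definition L_transform (A : {poly K}) : {poly K} :=
  gl2_act A 1 0 (- (A`_1 / (n%:R * A`_0))) 1.

Local Notation tofracp := (@tofrac {poly K}).

Lemma gl2_actE (A : {poly K}) (a b c d : K) :
  (size A <= n.+1)%N -> c *: 'X + d%:P != 0 :> {poly K} ->
  tofracp (gl2_act A a b c d) =
    tofracp (c *: 'X + d%:P) ^+ n *
    (map_poly (tofracp \o polyC) A).[tofracp (a *: 'X + b%:P)
                                      / tofracp (c *: 'X + d%:P)].
Proof.
move=> szA nz; set q := c *: 'X + d%:P; set p := a *: 'X + b%:P.
have nzq : tofracp q != 0 by rewrite tofrac_eq0.
rewrite (@horner_coef_wide _ n.+1); last first.
  by rewrite (leq_trans _ szA) // size_poly.
rewrite /gl2_act rmorph_sum mulr_sumr; apply: eq_bigr => i _ /=.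
rewrite coef_map_id0 /= ?polyC0 ?tofrac0 // -mul_polyC !rmorphM /= !rmorphXn /=.
have le_in : (i <= n)%N by rewrite -ltnS.
rewrite expr_div_n -/p -/q [RHS]mulrCA; congr (_ * _).
rewrite [RHS]mulrCA; congr (_ * _).
have ->: tofracp q ^+ n = tofracp q ^+ (n - i) * tofracp q ^+ i.
  by rewrite -exprD subnK.
by rewrite mulfK; last by rewrite expf_neq0.
Qed.

Lemma U_transformE (A : {poly K}) : (size A <= n.+1)%N ->
  U_transform A = gl2_act A 1 (- (A`_n.-1 / (n%:R * A`_n))) 0 1.
Proof.
move=> szA; rewrite /U_transform /gl2_act comp_polyE scale1r scale0r add0r.
rewrite polyCN (big_ord_widen _ (fun i => A`_i *: _ ^+ i) szA) big_mkcond.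
apply: eq_bigr => i _ /=; rewrite expr1n mulr1.
by case: ltnP => // /(nth_default _) ->; rewrite scale0r.
Qed.

End Transforms.

(* Main.v *)
(* A factorization A = F H into factors of formal degrees r + s = n is carried
   by the substitution to a factorization of the transform B into factors of the
   same formal degrees, so it is enough to see that r = 0 or s = 0 for B = F H
   Eisenstein-Dumas. Put g = v(b_0) - v(b_n). By (D2) the function
   n v(b_i) + i g is minimal at i = 0 and i = n; by Gauss's lemma
   n v(f_i) + i g is then minimal at both i = 0 and i = r, whence
   n (v(f_0) - v(f_r)) = r g. If 0 < r < n, then k = n / gcd(n, r) > 1 divides g
   in G, against (D1). *)

Require Import Defs.
From mathcomp Require Import all_boot all_order all_algebra.

Import Order.TTheory GRing.Theory Num.Theory.
Local Open Scope ring_scope.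

(** * Torsion and divisibility in ordered groups *)

Section OrderedGroupTheory.
Variable G : orderedGroupType.
Implicit Types x y z t : G.

Lemma og_lerD x y z t : x <= y -> z <= t -> x + z <= y + t.
Proof.
move=> xy zt; apply: (le_trans (y := x + t)); first exact: og_lerD2l.
by rewrite ![_ + t]addrC; apply: og_lerD2l.
Qed.

Lemma og_mulrn_ge0 x k : 0 <= x -> 0 <= x *+ k.
Proof.
move=> x0; elim: k => // k IHk.
by rewrite mulrS -[X in X <= _](addr0 0); apply: og_lerD.
Qed.

(** If [0 <= z] and [k > 0], then [z <= z *+ k], so a vanishing multiple squeezes [z] to 0; a
    negative element is replaced by its opposite. *)
Lemma og_mulrn_eq0 x k : (0 < k)%N -> x *+ k = 0 -> x = 0.
Proof.
have pos z : 0 <= z -> z *+ k.-1.+1 = 0 -> z = 0.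
  move=> z0 zk; apply/le_anti; rewrite z0 andbT -zk mulrS -{1}(addr0 z).
  by apply: og_lerD => //; apply: og_mulrn_ge0.
move=> k0; rewrite -(prednK k0) => xk.
case/orP: (og_total 0 x) => x0; first exact: pos.
apply/eqP; rewrite -oppr_eq0; apply/eqP; apply: pos; last first.
  by rewrite mulNrn xk oppr0.
by have := og_lerD2l (- x) _ _ x0; rewrite addr0 addNr.
Qed.

Lemma og_mulrnI x y k : (0 < k)%N -> x *+ k = y *+ k -> x = y.
Proof.
move=> k0 xy; apply/eqP; rewrite -subr_eq0; apply/eqP.
by apply: (@og_mulrn_eq0 _ k) => //; rewrite mulrnBl xy subrr.
Qed.

(** Bézout: from [a * r = b * k + 1], [y] equals [y *+ (r * a) - y *+ (b * k)], and [y *+ r] is a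
    multiple of [k]. *)
Lemma og_divisible_coprime x y k r :
  (0 < k)%N -> coprime k r -> x *+ k = y *+ r -> exists z, y = z *+ k.
Proof.
move=> k0 cop xy; case: (posnP r) => [r0 | r_gt0].
  move: cop; rewrite r0 /coprime gcdn0 => /eqP k1.
  by exists y; rewrite k1 mulr1n.
case: (egcdnP k r_gt0) => a b ab _.
exists (x *+ a - y *+ b).
rewrite mulrnBl mulrnAC xy -!mulrnA [(r * a)%N]mulnC ab gcdnC (eqP cop).
by rewrite mulrnDr mulr1n addrAC subrr add0r.
Qed.

End OrderedGroupTheory.

(** * Inequalities in the group with infinity *)

Section WithInftyTheory.
Variable G : orderedGroupType.
Local Notation T := (with_infty G).
Implicit Types a b c d : T.

Lemma wi_le_infty a : a <= infty.
Proof. by case: a. Qed.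

Lemma wi_leD a b c d : a <= b -> c <= d -> a + c <= b + d.
Proof.
by case: a b c d => [a|] [b|] [c|] [d|] // ab cd; apply: (@og_lerD G).
Qed.

(** A finite [c] can be cancelled; for [c = infty] both sums would be infinite. *)
Lemma wi_ltD a b c d : c != infty -> a < b -> c <= d -> a + c < b + d.
Proof.
case: c => // c _; rewrite !lt_neqAle => /andP[neq ab] cd.
rewrite wi_leD // andbT; apply: contraNneq neq => E.
case: a b d ab cd E => [a|] [b|] [d|] // ab cd [E].
apply/eqP; congr Some; apply/le_anti; rewrite [X in X && _]ab /=.
have := og_lerD2l (- c) _ _ (og_lerD2l b _ _ cd : b + c <= b + d).
by rewrite -E ![- c + _]addrC !addrK.
Qed.

Lemma wi_mulrn (g : G) k : (Some g : T) *+ k = Some (g *+ k).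
Proof. by elim: k => // k IHk; rewrite !mulrS IHk. Qed.

Lemma wi_inftyMn k : (0 < k)%N -> (infty : T) *+ k = infty.
Proof. by case: k => // k _; rewrite mulrS. Qed.

Lemma wi_leMn a b k : a <= b -> a *+ k <= b *+ k.
Proof. by move=> ab; elim: k => // k IHk; rewrite !mulrS wi_leD. Qed.

Lemma first_min (f : nat -> T) n :
  exists2 i, forall j, (j < i)%N -> f i < f j
           & forall j, (j <= n)%N -> f i <= f j.
Proof.
elim: n => [|n [i lt_i le_i]]; first by exists 0 => // [[]].
case: (leP (f i) (f n.+1)) => [le | lt].
  by exists i => // j; rewrite leq_eqVlt => /predU1P[-> // | /le_i].
exists n.+1 => j; last rewrite leq_eqVlt => /predU1P[-> // |] jn.
  by rewrite ltnS => /le_i; apply: lt_le_trans.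
exact: (ltW (lt_le_trans lt (le_i j jn))).
Qed.

End WithInftyTheory.

(** * Weights of coefficients and Gauss's lemma *)

Section Valuation.
Context {K : fieldType} {G : orderedGroupType} (v : krull_valuation K G).

Lemma val0 : v 0 = infty.
Proof. exact/valuation_inftyP. Qed.

Lemma val_eq_infty x : (v x == infty) = (x == 0).
Proof. by apply/eqP/eqP; case: (valuation_inftyP v x). Qed.

Lemma val_finite x : x != 0 -> v x = Some (finite_part (v x)).
Proof. by rewrite -val_eq_infty; case: (v x). Qed.

Lemma val1 : v 1 = 0.
Proof.
have := valuationM v 1 1; rewrite mulr1 (val_finite 1) ?oner_neq0 //.
by case=> /eqP; rewrite -subr_eq0 opprD addNKr oppr_eq0 => /eqP ->.
Qed.

Lemma valN x : v (- x) = v x.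
Proof.
have nz : -1 != 0 :> K by rewrite oppr_eq0 oner_neq0.
rewrite -mulN1r valuationM.
suff -> : v (-1) = 0 by rewrite add0r.
(* Twice [v (-1)] is [v 1 = 0], and the group has no torsion. *)
have := valuationM v (-1) (-1); rewrite mulrNN mulr1 val1 (val_finite _ nz).
by case=> /esym; rewrite -mulr2n => /(@og_mulrn_eq0 G _ 2 isT) ->.
Qed.

(* n times the value of x X^k under the extension of v to K[X] which gives X
   the value g / n *)
Definition weight (n : nat) (g : G) (k : nat) (x : K) : with_infty G :=
  v x *+ n + Some (g *+ k).

Variables (n : nat) (g : G).
Hypothesis n_gt0 : (0 < n)%N.
Local Notation wt := (weight n g).

Lemma weight0 k : wt k 0 = infty.
Proof. by rewrite /weight val0 wi_inftyMn. Qed.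

Lemma weight_eq_infty k x : (wt k x == infty) = (x == 0).
Proof.
have [-> | nz] := eqVneq x 0; first by rewrite weight0 eqxx.
by rewrite /weight (val_finite _ nz) wi_mulrn.
Qed.

Lemma weightM i j x y : wt (i + j) (x * y) = wt i x + wt j y.
Proof.
by rewrite /weight valuationM mulrnDl mulrnDr addrACA.
Qed.

Lemma weightN k x : wt k (- x) = wt k x.
Proof. by rewrite /weight valN. Qed.

Lemma weightD_gt c k x y : c < wt k x -> c < wt k y -> c < wt k (x + y).
Proof.
move=> cx cy; have := valuationD v x y.
rewrite ge_min => /orP[] le.
  by apply: (lt_le_trans cx); rewrite wi_leD // wi_leMn.
by apply: (lt_le_trans cy); rewrite wi_leD // wi_leMn.
Qed.

Lemma weight_sum_gt (I : finType) (P : pred I) (F : I -> K) c k :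
  c != infty -> (forall i, P i -> c < wt k (F i)) ->
  c < wt k (\sum_(i | P i) F i).
Proof.
move=> c_fin cF; elim/big_ind: _ => //; last exact: weightD_gt.
by rewrite weight0 lt_neqAle c_fin wi_le_infty.
Qed.

Lemma first_min_weight (F : {poly K}) : F != 0 ->
  exists i, [/\ F`_i != 0, forall j, (j < i)%N -> wt i F`_i < wt j F`_j
              & forall j, wt i F`_i <= wt j F`_j].
Proof.
move=> nzF; have [i lt_i le_i] := first_min _ (fun j => wt j F`_j) (size F).
have le j : wt i F`_i <= wt j F`_j.
  case: (leqP j (size F)) => [/le_i // | /ltnW szF].
  by rewrite (nth_default _ szF) weight0 wi_le_infty.
(* A zero coefficient has infinite weight, so it cannot lie below the finite weight of the leading
   coefficient. *)
exists i; split=> //; apply: contraTneq (le (size F).-1) => ->.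
rewrite weight0 -ltNge lt_neqAle wi_le_infty andbT weight_eq_infty.
by rewrite -/(lead_coef F) lead_coef_eq0.
Qed.

(* Gauss's lemma: at the least indices i, j of minimal weight in F and H, the
   term F_i H_j strictly dominates the other terms of (F H)_(i + j). *)
Lemma gauss_weight (F H : {poly K}) c : F != 0 -> H != 0 ->
  (forall k, c <= wt k (F * H)`_k) ->
  exists a b, [/\ b != infty, c <= a + b,
    forall i, a <= wt i F`_i & forall j, b <= wt j H`_j].
Proof.
move=> nzF nzH le_c.
have [i [nzi lti lei]] := first_min_weight _ nzF.
have [j [nzj ltj lej]] := first_min_weight _ nzH.
have bfin : wt j H`_j != infty by rewrite weight_eq_infty.
exists (wt i F`_i), (wt j H`_j); split=> //.
rewrite -weightM leNgt; apply/negP => lt_c.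
have fin : wt (i + j) (F`_i * H`_j) != infty.
  by rewrite weight_eq_infty mulf_neq0.
have := lt_le_trans lt_c (le_c (i + j)%N); rewrite coefM.
have i_lt : (i < (i + j).+1)%N by rewrite ltnS leq_addr.
rewrite (bigD1 (Ordinal i_lt)) //= addKn.
set S := (X in _ + X) => ltS.
(* Otherwise [F_i H_j], the full coefficient minus [S], would be a sum of two terms of weight
   greater than its own. *)
suff ltS' : wt (i + j) (F`_i * H`_j) < wt (i + j) (- S).
  by have := weightD_gt _ _ _ _ ltS ltS'; rewrite addrK ltxx.
rewrite weightN; apply: weight_sum_gt => // k nki.
have le_k : (k <= i + j)%N by rewrite -ltnS.
rewrite -{2}(subnKC le_k) !weightM.
(* Either [k < i] or [i + j - k < j], so one factor precedes a first minimum and is strictly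
   heavier. *)
have [ki | ik | ki] := ltngtP k i.
- by apply: wi_ltD; last exact: lej; rewrite ?lti.
- rewrite addrC [X in _ < X]addrC; apply: wi_ltD; last exact: lei.
    by rewrite weight_eq_infty.
  by apply: ltj; rewrite ltn_subLR // ltn_add2r.
- by case/eqP: nki; apply: val_inj.
Qed.

End Valuation.

(** * Formal factors of an Eisenstein-Dumas polynomial *)

Lemma size_polyM_le_add (R : nzRingType) (r s : nat) (F H : {poly R}) :
  (size F <= r.+1)%N -> (size H <= s.+1)%N -> (size (F * H)%R <= (r + s).+1)%N.
Proof.
move=> szF szH; apply: leq_trans (size_polyMleq _ _) _.
by have := leq_add szF szH; rewrite addnS addSn; case: (_ + _)%N.
Qed.

Lemma eisenstein_dumas_factor (K : fieldType) (G : orderedGroupType)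
    (v : krull_valuation K G) (r s : nat) (F H : {poly K}) :
  (size F <= r.+1)%N -> (size H <= s.+1)%N ->
  eisenstein_dumas v (r + s) (F * H) -> r = 0%N \/ s = 0%N.
Proof.
move=> szF szH [_ D0 D1 D2].
case: (posnP r) => [|r_gt0]; first by left.
case: (posnP s) => [|s_gt0]; first by right.
set n := (r + s)%N in D0 D1 D2.
have n_gt0 : (0 < n)%N by rewrite addn_gt0 r_gt0.
have FH0 : (F * H)`_0 = F`_0 * H`_0 by rewrite coef0M.
have FHn : (F * H)`_n = F`_r * H`_s.
  have r_lt : (r < n.+1)%N by rewrite ltnS leq_addr.
  rewrite coefM (bigD1 (Ordinal r_lt)) //= addKn big1 ?addr0 // => k nkr.
  have [kr | rk | kr] := ltngtP k r.
  - rewrite [H`_ _]nth_default ?mulr0 // (leq_trans szH) // ltn_subRL.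
    by rewrite ltn_add2r.
  - by rewrite [F`_ _]nth_default ?mul0r // (leq_trans szF).
  - by case/eqP: nkr; apply: val_inj.
move: (D0); rewrite FH0 FHn !mulf_eq0 !negb_or.
case/andP=> /andP[nzF0 nzH0] /andP[nzFr nzHs].
have nzF : F != 0 by apply: contraNneq nzF0 => ->; rewrite coef0.
have nzH : H != 0 by apply: contraNneq nzH0 => ->; rewrite coef0.
have nzb0 : (F * H)`_0 != 0 by rewrite FH0 mulf_neq0.
have nzbn : (F * H)`_n != 0 by rewrite FHn mulf_neq0.
have [b0 bn] := (val_finite v _ nzb0, val_finite v _ nzbn).
move: D1; set g := _ - _ => D1.
(* The slope [g] is chosen to give both end coefficients the same weight. *)
have wtn : weight v n g n (F * H)`_n = weight v n g 0 (F * H)`_0.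
  rewrite /weight b0 bn !wi_mulrn; congr Some.
  by rewrite /g mulrnBl mulr0n addr0 addrC subrK.
have le_c k : weight v n g 0 (F * H)`_0 <= weight v n g k (F * H)`_k.
  case: (leqP k n) => [k_le | n_lt]; last first.
    rewrite [(F * H)`_k]nth_default ?weight0 ?wi_le_infty //.
    exact: leq_trans (size_polyM_le_add _ _ _ _ _ szF szH) n_lt.
  (* Adding [g *+ k] to the left side of (D2) gives the weight at 0. *)
  have -> : weight v n g 0 (F * H)`_0 =
      v (F * H)`_0 *+ (n - k) + v (F * H)`_n *+ k + Some (g *+ k).
    rewrite /weight b0 bn !wi_mulrn; congr Some => /=.
    rewrite mulr0n addr0 /g mulrnBl -addrA [X in _ = _ + X]addrC subrK.
    by rewrite -mulrnDr subnK.
  by apply: wi_leD (D2 k k_le) _.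
have [a [b [b_fin le_ab minF minH]]] :=
  gauss_weight v n g n_gt0 _ _ _ nzF nzH le_c.
(* If the weight of [F_i] exceeded [a], the sum would exceed [a + b], as [b] is finite. This applies
   to the index pairs (0, 0) and (r, s). *)
have min_eq i j : weight v n g i F`_i + weight v n g j H`_j =
    weight v n g 0 (F * H)`_0 -> weight v n g i F`_i = a.
  move=> E; apply/eqP; rewrite eq_le minF andbT leNgt; apply/negP => lt_a.
  have := wi_ltD _ _ _ _ _ b_fin lt_a (minH j).
  by rewrite E ltNge le_ab.
have F0a : weight v n g 0 F`_0 = a.
  by apply: (min_eq _ 0%N); rewrite -weightM FH0.
have Fra : weight v n g r F`_r = a.
  by apply: (min_eq _ s); rewrite -weightM -wtn FHn.
have := etrans F0a (esym Fra).
rewrite /weight (val_finite v _ nzF0) (val_finite v _ nzFr) !wi_mulrn.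
set x := finite_part _; set y := finite_part _ => -[] /=.
rewrite mulr0n addr0 => xy.
have {}xy : (x - y) *+ n = g *+ r by rewrite mulrnBl xy addrC addKr.
set d := gcdn n r; have d_gt0 : (0 < d)%N by rewrite gcdn_gt0 n_gt0.
have [dn dr] := (dvdn_gcdl n r, dvdn_gcdr n r).
have r_lt : (r < n)%N by rewrite -{1}(addn0 r) ltn_add2l.
(* Here [d <= r < n]. *)
have k_gt1 : (1 < n %/ d)%N.
  rewrite ltn_divRL // mul1n (leq_ltn_trans _ r_lt) //; exact: dvdn_leq.
case: (D1 (n %/ d)%N k_gt1); first exact: dvdn_div.
apply: (og_divisible_coprime _ (x - y) g _ (r %/ d)%N); first exact: ltnW.
  rewrite /coprime -(eqn_pmul2r d_gt0) muln_gcdl !divnK //.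
  by rewrite mul1n.
(* Torsion-freeness allows division of [(x - y) *+ n = g *+ r] by [d]. *)
apply: (og_mulrnI _ _ _ _ d_gt0).
by rewrite -!mulrnA !divnK.
Qed.

(** * Transport of factorizations by the substitution *)

Section Gl2Act.
Context {K : fieldType}.
Implicit Types (F H A : {poly K}) (a b c d : K).

(** In the fraction field the action is evaluation times a power of the denominator, and both are
    multiplicative. *)
Lemma gl2_actM r s F H a b c d : c *: 'X + d%:P != 0 :> {poly K} ->
  (size F <= r.+1)%N -> (size H <= s.+1)%N ->
  gl2_act (r + s) (F * H) a b c d = gl2_act r F a b c d * gl2_act s H a b c d.
Proof.
move=> nz szF szH.
have szFH := size_polyM_le_add _ _ _ _ _ szF szH.
apply/eqP; rewrite -tofrac_eq; apply/eqP.
rewrite rmorphM /= !gl2_actE // rmorphM /= hornerM exprD.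
by rewrite mulrACA.
Qed.

(** Only a bound: the substitution may lower the degree, which is why formal degrees are tracked. *)
Lemma size_gl2_act n A a b c d : (size (gl2_act n A a b c d) <= n.+1)%N.
Proof.
have lin x y m : (size ((x *: 'X + y%:P) ^+ m : {poly K})%R <= m.+1)%N.
  apply: leq_trans (size_poly_exp_leq _ _) _; rewrite ltnS.
  have : (size (x *: 'X + y%:P : {poly K})%R <= 2)%N.
    rewrite (leq_trans (size_polyD _ _)) // geq_max.
    rewrite (leq_trans (size_polyC_leq1 _)) // andbT.
    by rewrite (leq_trans (size_scale_leq _ _)) // size_polyX.
  by case: size => [|[|[]]] //= _; rewrite ?mul0n ?mul1n.
apply: (leq_trans (size_sum _ _ _)); apply/bigmax_leqP => i _.
apply: leq_trans (size_scale_leq _ _) _.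
have i_le : (i <= n)%N by rewrite -ltnS.
have := size_polyM_le_add _ _ _ _ _ (lin a b i) (lin c d (n - i)%N).
by rewrite subnKC.
Qed.

Lemma irreducible_gl2_act (G : orderedGroupType) (v : krull_valuation K G)
    n A a b c d : (0 < n)%N -> size A = n.+1 ->
  c *: 'X + d%:P != 0 :> {poly K} ->
  eisenstein_dumas v n (gl2_act n A a b c d) -> irreducible_poly A.
Proof.
move=> n_gt0 szA nz ED; split=> [|q q1 /dvdpP[Q AE]]; first by rewrite szA.
have nzA : A != 0 by rewrite -size_poly_eq0 szA.
move: (nzA); rewrite AE mulf_eq0 negb_or => /andP[nzQ nzq].
have szQ : size Q = (size Q).-1.+1 by rewrite prednK // size_poly_gt0.
have szq : size q = (size q).-1.+1 by rewrite prednK // size_poly_gt0.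
have nE : n = ((size Q).-1 + (size q).-1)%N.
  by apply: succn_inj; rewrite -szA AE size_mul // szQ szq addnS addSn.
have [|||Q0|q0] := @eisenstein_dumas_factor _ _ v (size Q).-1 (size q).-1
    (gl2_act (size Q).-1 Q a b c d) (gl2_act (size q).-1 q a b c d).
- exact: size_gl2_act.
- exact: size_gl2_act.
- by rewrite -gl2_actM // -?szQ -?szq // -AE -nE.
(* A constant cofactor [Q] makes [q] an associate of [A]; a constant [q] is excluded by [q1]. *)
- rewrite Q0 in szQ; case: (size_poly1P _ (introT eqP szQ)) => x nzx ->.
  by rewrite mul_polyC eqp_sym eqp_scale.
- by rewrite szq q0 in q1.
Qed.

End Gl2Act.

Theorem theorem1p3 (K : fieldType) (G : orderedGroupType)
    (v : krull_valuation K G) (hv : nontrivial_valuation v)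
    (n : nat) (A : {poly K}) (hdeg : size A = n.+1) (hn : n%:R != 0 :> K)
    (hA : eisenstein_dumas v n (U_transform n A) \/
          (A`_0 != 0 /\ eisenstein_dumas v n (L_transform n A))) :
  irreducible_poly A.
Proof.
have n_gt0 : (0 < n)%N by case: n hn {hdeg hA} => //; rewrite eqxx.
(* Both transforms have a denominator with constant term 1. *)
have den_neq0 (c : K) : c *: 'X + 1%:P != 0 :> {poly K}.
  apply: contraTneq (oner_neq0 K) => /(congr1 (coefp 0)) /=.
  by rewrite coefD coefZ coefX mulr0 add0r coefC coef0 /= => ->; rewrite eqxx.
case: hA => [|[_]] ED.
  rewrite U_transformE ?hdeg // in ED.
  exact: irreducible_gl2_act n_gt0 hdeg (den_neq0 0) ED.
exact: irreducible_gl2_act n_gt0 hdeg (den_neq0 _) ED.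
Qed.
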